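(* Let $A\in\mathbb{R}^{n\times n}$ be symmetric with eigenvalues $\alpha_1\ge\cdots\ge\alpha_n$, $g\in\mathbb{R}^n$ nonzero, $\Delta>0$, and consider the TRS of minimizing $\frac12x^TAx+x^Tg$ subject to $\|x\|\le\Delta$, in the easy case. With the notation of the context, suppose $\|x_{opt}\|=\|x_k\|=\Delta$, $k\in\{1,\ldots,k_{\max}\}$, and let $y=(y_1^T,y_2^T)^T$ be a unit-length eigenvector of $M$ associated with $\lambda_{opt}$. Then $$\lambda_{opt}-\lambda_k\le2s_k\Big(1+\frac{2\|y_1\|k\sqrt\kappa}{\|y_2\|\|A_{opt}\|}\Big)\Big(\frac{\sqrt\kappa-1}{\sqrt\kappa+1}\Big)^{2k},\qquad s_k=\frac{\|A_{opt}^{-1}x_{opt}\|}{\|g\|e_1^T(T_k+\lambda_{opt}I)^{-3}e_1}.$$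
   Context: Norms are Euclidean (spectral norm for matrices). $x_{opt}$ is a global minimizer of the TRS with multiplier $\lambda_{opt}\ge0$ ($(A+\lambda_{opt}I)x_{opt}=-g$, $\lambda_{opt}(\Delta-\|x_{opt}\|)=0$, $A+\lambda_{opt}I\succeq0$); easy case: $\lambda_{opt}>-\alpha_n$. $A_{opt}=A+\lambda_{opt}I$, $\kappa=(\alpha_1+\lambda_{opt})/(\alpha_n+\lambda_{opt})$. $M=\begin{pmatrix}-A&gg^T/\Delta^2\\ I&-A\end{pmatrix}$. Lanczos on $A$ with start $g$: $Q_k=[q_1,\ldots,q_k]$ orthonormal basis of $\mathrm{span}\{g,\ldots,A^{k-1}g\}$, $q_1=g/\|g\|$, $T_k=Q_k^TAQ_k$ tridiagonal, $AQ_k=Q_kT_k+\beta_kq_{k+1}e_k^T$; $k_{\max}$ the first breakdown step. GLTR: $x_k=Q_kh_k$, $h_k$ minimizes $\frac12h^TT_kh+\|g\|h^Te_1$ over $\|h\|\le\Delta$, multiplier $\lambda_k\ge0$ with $(T_k+\lambda_kI)h_k=-\|g\|e_1$, $\lambda_k(\Delta-\|h_k\|)=0$, $T_k+\lambda_kI\succeq0$. *)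

(* Defs.v *)
From HB Require Import structures.
From mathcomp Require Import all_boot all_order all_algebra.
From mathcomp Require Import boolp classical_sets reals.
Set Implicit Arguments. Unset Strict Implicit. Unset Printing Implicit Defensive.
Import Order.TTheory GRing.Theory Num.Theory.
Local Open Scope ring_scope.
Local Open Scope classical_set_scope.

Definition vnorm (R : realType) (n : nat) (v : 'cV[R]_n) : R :=
  Num.sqrt (\sum_(i < n) v i 0 ^+ 2).

Definition mxnorm (R : realType) (m n : nat) (B : 'M[R]_(m, n)) : R :=
  sup [set vnorm (B *m v) | v in [set v : 'cV[R]_n | vnorm v <= 1]].

(* first canonical basis vector e_1 (zero vector if k = 0) *)
Definition e1 (R : realType) (k : nat) : 'cV[R]_k := \col_(i < k) (i == 0 :> nat)%:R.

Definition psd (R : realType) (n : nat) (B : 'M[R]_n) : Prop :=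
  forall v : 'cV[R]_n, 0 <= (v^T *m B *m v) 0 0.

Definition trs_obj (R : realType) (n : nat) (A : 'M[R]_n) (g x : 'cV[R]_n) : R :=
  2^-1 * (x^T *m A *m x) 0 0 + (x^T *m g) 0 0.

Definition Mmat (R : realType) (n : nat) (A : 'M[R]_n) (g : 'cV[R]_n) (Delta : R)
  : 'M[R]_(n + n) :=
  block_mx (- A) ((Delta ^+ 2)^-1 *: (g *m g^T)) 1%:M (- A).

(* Krylov matrix masked to its first j columns: column i is A^i g for i < j,
   zero otherwise (as a k x n matrix of rows = transposed columns). *)
Definition krylov_rows (R : realType) (n k j : nat) (A : 'M[R]_n) (g : 'cV[R]_n)
  : 'M[R]_(k, n) :=
  \matrix_(i < k) (if (i < j)%N then ((A ^+ i) *m g)^T else 0).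

Definition first_cols (R : realType) (n k j : nat) (Q : 'M[R]_(n, k))
  : 'M[R]_(k, n) :=
  \matrix_(i < k) (if (i < j)%N then row i Q^T else 0).

(* Main.v *)
Require Import Defs.
From HB Require Import structures.
From mathcomp Require Import all_boot all_order all_algebra.
From mathcomp Require Import boolp classical_sets reals.
From mathcomp Require Import complex spectral ring lra zify.
Import Order.TTheory GRing.Theory Num.Theory.
Local Open Scope ring_scope.

(** Write [B = A + lamopt] and [S = T + lamopt]. Convexity of the secular
    function of [T] bounds [lamopt - lamk] by
    [(g^T B^-2 g - |g|^2 e1^T S^-2 e1) / (2 |g|^2 e1^T S^-3 e1)].
    The numerator is the error of the [k]-point Gauss quadrature rule (exact up
    to degree [2k - 1]) for [t^-2] against the spectral measure of [g]. Compare
    [t^-2] with the polynomial [p] such that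
    [1 - t^2 p = (1 + c0 t) tau(t)], where [tau] is the Chebyshev polynomial of
    degree [2k] shifted to the spectral interval with [tau(0) = 1] and
    [c0 = - tau'(0)]. This controls the errors of both measures by their
    inverse moments of order 1 and 2, and those of the quadrature rule are at
    most those of [g]. Finally [y1] and [y2] are proportional to [xopt] and
    [B^-1 xopt], which turns [|xopt| / |B^-1 xopt|] into [|y1| / |y2|]. *)

(** * Spectral measures and inverses of symmetric matrices *)

(** The complexification of [B] is hermitian, hence unitarily diagonalisable with real eigenvalues
    [D]. The weight [W i] is the squared modulus of the [i]-th coordinate of [v] in that
    eigenbasis. *)
Lemma spectral_measure {R : realType} {n : nat} (B : 'M[R]_n.+1) : B^T = B ->
  exists2 D : 'I_n.+1 -> R, (forall i, eigenvalue B (D i)) &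
  forall v : 'cV[R]_n.+1, exists2 W : 'I_n.+1 -> R, (forall i, 0 <= W i) &
  forall p, (v^T *m horner_mx B p *m v) 0 0 = \sum_i p.[D i] * W i.
Proof.
move=> Bsym; pose f := real_complex R; pose BC := map_mx f B.
have fR x : f x \is Num.real by apply/complex_realP; exists x.
have BCherm : BC \is hermsymmx.
  apply: realsym_hermsym; last by apply/mxOverP => i j; rewrite mxE fR.
  apply/is_hermitianmxP; rewrite expr0 scale1r map_mx_id//.
  by rewrite /BC map_trmx Bsym.
have BCn := hermitian_normalmx BCherm.
have /orthomx_spectralP := BCn.
set P := spectralmx BC; set sp := spectral_diag BC => BE.
have Pu : P \is unitarymx := spectral_unitarymx BC.
have Punit : P \in unitmx := spectral_unit BC.
have spR i : f (complex.Re (sp 0 i)) = sp 0 i.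
  by apply: RRe_real; exact: (mxOverP (hermitian_spectral_diag_real BCherm)).
exists (fun i => complex.Re (sp 0 i)) => [i|v].
  rewrite -(eigenvalue_map f) [X in eigenvalue _ X]spR.
  apply/eigenvalueP; exists (row i P).
    rewrite -row_mul -[map_mx f B]/BC BE !mulmxA mulmxV// mul1mx row_mul.
    by rewrite row_diag_mx -scalemxAl -rowE.
  apply/eqP => Pi0; have /row_freeP[Q PQ] : row_free P by rewrite row_free_unit.
  have /matrixP/(_ i i) := PQ; rewrite !mxE eqxx => /eqP.
  rewrite big1 1?eq_sym ?oner_eq0// => j _.
  by have /rowP/(_ j) := Pi0; rewrite !mxE => ->; rewrite mul0r.
pose u := P *m map_mx f v.
have uC : map_mx f v^T *m map_mx Num.conj P^T = map_mx Num.conj u^T.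
  rewrite /u trmx_mul map_mxM; congr (_ *m _).
  apply/matrixP => i j; rewrite !mxE; exact/esym/CrealP/fR.
exists (fun i => complex.Re (`|u i 0| ^+ 2)) => [i|p].
  have : 0 <= `|u i 0| ^+ 2 by exact: exprn_ge0 _ (normr_ge0 _).
  by rewrite lecE => /andP[].
have WE i : f (complex.Re (`|u i 0| ^+ 2)) = `|u i 0| ^+ 2.
  by apply: RRe_real; rewrite rpredX// normr_real.
apply: (@complexI R); rewrite -/f.
transitivity ((map_mx f (v^T *m horner_mx B p *m v)) 0 0); first by rewrite [RHS]mxE.
rewrite !map_mxM map_horner_mx -[map_mx f B]/BC BE horner_mx_uconjC//.
rewrite horner_mx_diag invmx_unitary//.
rewrite !mulmxA -[_ *m P *m _]mulmxA -/u uC.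
rewrite [RHS]rmorph_sum mxE; apply: eq_bigr => i _.
rewrite mul_mx_diag [RHS]rmorphM [X in _ = _ * X]WE.
clearbody u; rewrite !mxE -spR horner_map normCK /=; ring.
Qed.

(** By Cayley-Hamilton, [1 - chi / chi(0)] takes the value 1 at [B], and it is divisible by ['X];
    [psi] is the quotient. This brings powers of the inverse within reach of [spectral_measure]. *)
Lemma invmx_poly {R : realType} {n : nat} (B : 'M[R]_n.+1) :
  ~~ eigenvalue B 0 ->
  [/\ B \in unitmx & exists2 psi : {poly R}, horner_mx B psi = invmx B &
  forall a, eigenvalue B a -> psi.[a] = a^-1].
Proof.
move=> B0; pose chi := char_poly B.
have c0 : chi.[0] != 0 by move: B0; rewrite eigenvalue_root_char.
pose q := 1 - chi.[0]^-1 *: chi.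
have /factor_theorem[psi] : root q 0.
  by rewrite rootE !hornerE mulVf// subrr.
rewrite subr0 => qE.
have Bpsi : horner_mx B psi *m B = 1%:M.
  rewrite -{2}(horner_mx_X B) -[_ *m _]/(_ * _) -rmorphM -qE /q rmorphB.
  by rewrite /= linearZ /= Cayley_Hamilton scaler0 subr0 rmorph1.
have [_ Bu] := mulmx1_unit Bpsi; split=> //; exists psi.
  by rewrite -[LHS](mulmxK Bu) Bpsi mul1mx.
move=> a aB; have a0 : a != 0 by apply: contraNneq B0 => <-.
have /(congr1 (fun p => p.[a])) := qE; rewrite !hornerE.
move: aB; rewrite eigenvalue_root_char => /rootP ->; rewrite mulr0 subr0 => E.
by rewrite -[RHS]mul1r E mulfK.
Qed.

(** * Inverse moments under a quadrature rule *)

(** Each factor [1 - 'X / x] has a geometric series with nonnegative coefficients as its inverse.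
    The induction multiplies by one truncated series [gs] and truncates again. *)
Lemma inverse_power_series_trunc {R : realType} (m : nat) (s : seq R) :
  all (fun x => 0 < x) s ->
  exists r u : {poly R}, [/\ (size r <= m)%N, (forall i, 0 <= r`_i) &
    1 - (\prod_(x <- s) (1 - x^-1 *: 'X)) * r = 'X^m * u].
Proof.
elim: s => [_|x s IH /=].
  exists (take_poly m 1), (drop_poly m 1); split; first exact: size_take_poly.
    by move=> i; rewrite coef_take_poly coefC; case: ifP => // _; case: ifP.
  rewrite big_nil mul1r -{1}(poly_take_drop m 1); ring.
case/andP=> x0 /IH[r [u [sr r0 E]]].
pose gs : {poly R} := \sum_(i < m) (x^-1 *: 'X) ^+ i.
pose t := gs * r.
(* The three terms are the cofactors of ['X^m] coming from the tail of [gs], the induction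
   hypothesis and the truncation of [t]. *)
exists (take_poly m t), (x^- m *: 1 + (1 - x^- m *: 'X^m) * u
   + \prod_(x <- x :: s) (1 - x^-1 *: 'X) * drop_poly m t).
split; first exact: size_take_poly.
  move=> i; rewrite coef_take_poly; case: ifP => // _; rewrite coefM.
  apply: sumr_ge0 => j _; apply: mulr_ge0; last exact: r0.
  rewrite /gs coef_sum; apply: sumr_ge0 => l _.
  by rewrite exprZn coefZ coefXn mulr_ge0// ?exprn_ge0// ?invr_ge0 ?ltW// ler0n.
have tE : take_poly m t = t - drop_poly m t * 'X^m.
  by rewrite -{2}(poly_take_drop m t) addrK.
have gE : (1 - x^-1 *: 'X) * gs = 1 - x^- m *: 'X^m.
  have := subrX1 (x^-1 *: 'X : {poly R}) m; rewrite exprZn exprVn => ge.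
  by rewrite -opprB mulNr -ge opprB.
have tP : \prod_(x <- x :: s) (1 - x^-1 *: 'X) * t
    = (1 - x^- m *: 'X^m) * (1 - 'X^m * u).
  by rewrite -E -gE big_cons /t; ring.
rewrite tE mulrBr tP -!mul_polyC; ring.
Qed.

(* With [chi] vanishing exactly at the nodes [theta], interpolate [t ^- m] by
   [u = t ^- m * (1 - chi ^+ 2 * r)], where [r] truncates the power series of
   [chi ^- 2]; its coefficients are nonnegative, so [u <= t ^- m] for [t > 0]. *)
Lemma moment_inverse_le {R : realType} {I J : finType} (m : nat)
    (theta w : I -> R) (D W : J -> R) :
  (0 < m)%N -> (forall i, 0 < theta i) -> (forall j, 0 < D j) -> (forall j, 0 <= W j) ->
  (forall p : {poly R}, (size p <= 2 * #|I|)%N ->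
     \sum_i p.[theta i] * w i = \sum_j p.[D j] * W j) ->
  \sum_i theta i ^- m * w i <= \sum_j D j ^- m * W j.
Proof.
move=> m0 th0 D0 W0 quad; pose s := [seq theta i | i <- enum I].
(* Every node is listed twice, so that the product is [chi ^+ 2]. *)
have spos : all (fun x => 0 < x) (s ++ s).
  by rewrite all_cat andbb; apply/allP => _ /mapP[i _ ->].
have [r [u [sr r0]]] := inverse_power_series_trunc m _ spos.
pose chi : {poly R} := \prod_(x <- s) (1 - x^-1 *: 'X).
rewrite big_cat /= -/chi => E.
have schi : (size chi <= #|I|.+1)%N.
  have -> : #|I| = size s by rewrite size_map -cardE.
  rewrite /chi; elim: s {spos chi E r0 sr} => [|x s IH].
    by rewrite big_nil size_poly1.
  rewrite big_cons; apply: leq_trans (size_polyMleq _ _) _.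
  have : (size (1 - x^-1 *: 'X : {poly R})%R <= 2)%N.
    rewrite (leq_trans (size_polyD _ _))// geq_max size_poly1 size_polyN.
    by rewrite (leq_trans (size_scale_leq _ _))// size_polyX.
  by move: IH => /=; lia.
(* The product [chi ^+ 2 * r] has size at most [2 * #|I| + m]; dividing by ['X^m] lands exactly in
   the range where [quad] applies. *)
have su : (size u <= 2 * #|I|)%N.
  have [->|u0] := eqVneq u 0; first by rewrite size_poly0.
  have : (size ('X^m * u)%R <= 2 * #|I| + m)%N.
    rewrite -E (leq_trans (size_polyD _ _))// geq_max size_poly1 size_polyN.
    apply/andP; split; first by rewrite addn_gt0 m0 orbT.
    have arith a b c d e l : (a <= l.+1 -> b <= e -> c <= (a + a).-1 ->
      d <= (c + b).-1 -> d <= 2 * l + e)%N by lia.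
    exact: arith schi sr (size_polyMleq _ _) (size_polyMleq _ _).
  by rewrite mulrC size_mulXn//; lia.
have uE x : 0 < x -> u.[x] = x ^- m * (1 - chi.[x] ^+ 2 * r.[x]).
  move=> x0; have /(congr1 (fun p => p.[x])) := E; rewrite !hornerE => ->.
  by rewrite mulrA mulVf ?mul1r// expf_neq0// gt_eqF.
have -> : \sum_i theta i ^- m * w i = \sum_i u.[theta i] * w i.
  apply: eq_bigr => i _; rewrite uE//.
  suff -> : chi.[theta i] = 0 by rewrite expr0n mul0r subr0 mulr1.
  apply/eqP; rewrite /chi horner_prod prodf_seq_eq0; apply/hasP.
  exists (theta i); first by rewrite map_f// mem_enum.
  by rewrite !hornerE mulVf ?subrr// gt_eqF.
rewrite quad//; apply: ler_sum => j _; rewrite ler_wpM2r// uE//.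
apply: ler_piMr; first by rewrite invr_ge0 exprn_ge0// ltW.
rewrite gerBl mulr_ge0 ?sqr_ge0//.
rewrite horner_coef; apply: sumr_ge0 => i _.
by rewrite mulr_ge0// exprn_ge0// ltW.
Qed.

(** * Chebyshev polynomials and the residual polynomial *)

(* The pair (T_m(L), U_(m-1)(L)) of Chebyshev polynomials of both kinds. *)
Fixpoint cheb {R : realType} (L : {poly R}) (m : nat) : {poly R} * {poly R} :=
  if m is m'.+1 then
    let: (t, u) := cheb L m' in (L * t + (L ^+ 2 - 1) * u, t + L * u)
  else (1, 0).

Lemma cheb_pell {R : realType} (L : {poly R}) m :
  (cheb L m).1 ^+ 2 - (L ^+ 2 - 1) * (cheb L m).2 ^+ 2 = 1.
Proof.
elim: m => [|m] /=; first by rewrite expr0n mulr0 subr0 expr1n.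
by case: (cheb L m) => t u /= E; rewrite -[RHS]E; ring.
Qed.

(** The induction for the first derivative needs the second one, which is kept multiplied by
    [L ^+ 2 - 1] to avoid a division. *)
Lemma cheb_deriv {R : realType} (L : {poly R}) m :
  (cheb L m).1^`() = (cheb L m).2 * L^`() *+ m /\
  (L ^+ 2 - 1) * (cheb L m).2^`() =
    ((cheb L m).1 *+ m - L * (cheb L m).2) * L^`().
Proof.
elim: m => [|m] /=; first by rewrite !derivE !mulr0n !mulr0 subr0 mul0r.
case: (cheb L m) => t u /= [t' u'].
have uE : (L ^+ 2 - 1) * u^`() = (t *+ m - L * u) * L^`() by [].
rewrite !derivE t' !mulrS; split.
  transitivity (L^`() * t + L * (u * L^`() *+ m) + 2 * L * L^`() * u
     + (L ^+ 2 - 1) * u^`()); first by ring.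
  by rewrite uE; ring.
transitivity ((L ^+ 2 - 1) * (u * L^`() *+ m + L^`() * u)
   + L * ((L ^+ 2 - 1) * u^`())); first by ring.
by rewrite uE; ring.
Qed.

Lemma size_cheb {R : realType} (L : {poly R}) m : (size L <= 2)%N ->
  (size (cheb L m).1 <= m.+1)%N /\ (size (cheb L m).2 <= m)%N.
Proof.
move=> sL; elim: m => [|m] /=; first by rewrite size_poly1 size_poly0.
case: (cheb L m) => t u /= [st su].
have sM (p q : {poly R}) i j : (size p <= i.+1 -> size q <= j ->
    size (p * q)%R <= i + j)%N.
  by move=> pi qj; apply: leq_trans (size_polyMleq _ _) _; 
     rewrite -subn1 leq_subLR add1n -addSn leq_add.
split; rewrite (leq_trans (size_polyD _ _))// geq_max.
  rewrite (sM _ _ 1 _ sL st)/= (sM _ _ 2 _ _ su)//.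
  rewrite (leq_trans (size_polyD _ _))// geq_max size_polyN size_poly1 andbT.
  by rewrite (leq_trans (size_polyMleq _ _))//; case: (size L) sL => [|[|[|]]].
by rewrite st (sM _ _ 1 _ sL su).
Qed.

(** Pell's identity writes the square of the value as 1 minus [(1 - L^2) U^2], a nonnegative
    quantity when [L] has modulus at most 1. *)
Lemma cheb_abs_le1 {R : realType} (L : {poly R}) m x :
  `|L.[x]| <= 1 -> `|(cheb L m).1.[x]| <= 1.
Proof.
move=> Lx; have /(congr1 (fun p => p.[x])) := cheb_pell L m.
rewrite !(hornerD, hornerN, hornerM, horner_exp, hornerC) => E.
rewrite -(@expr_le1 _ 2)// real_normK ?num_real//.
have : L.[x] ^+ 2 <= 1 by rewrite -(real_normK (num_real _)) expr_le1.
have := sqr_ge0 (cheb L m).2.[x]; move: E.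
move: ((cheb L m).1.[x]) ((cheb L m).2.[x]) (L.[x]) => t u l E u0 l1.
have : 0 <= (1 - l ^+ 2) * u ^+ 2 by rewrite mulr_ge0// subr_ge0.
lra.
Qed.

Lemma cheb_eval {R : realType} (L : {poly R}) m x s :
  s ^+ 2 = L.[x] ^+ 2 - 1 ->
  (cheb L m).1.[x] + s * (cheb L m).2.[x] = (L.[x] + s) ^+ m /\
  (cheb L m).1.[x] - s * (cheb L m).2.[x] = (L.[x] - s) ^+ m.
Proof.
move=> sE; elim: m => [|m] /=; first by rewrite !hornerC mulr0 addr0 subr0 !expr0.
case: (cheb L m) => t u /= [E1 E2]; rewrite ![_ ^+ m.+1]exprS -E1 -E2.
rewrite !(hornerD, hornerN, hornerM, horner_exp, hornerC, hornerZ, hornerX).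
by split; rewrite -sE; ring.
Qed.

(* The residual is the shifted Chebyshev polynomial of degree [2 * k],
   normalised at 0 and multiplied by [1 + c0 * 'X] to cancel its linear term;
   [2 * k * r / (a * r ^+ 2)] bounds [c0]. *)
Lemma cheb_residual {R : realType} (a r : R) (k : nat) :
  0 < a -> 1 <= r -> (0 < k)%N ->
  exists2 p : {poly R}, (size p <= 2 * k)%N &
  forall t, a <= t <= a * r ^+ 2 ->
  `|1 - t ^+ 2 * p.[t]| <=
     2 * (1 + 2 * k%:R * r / (a * r ^+ 2) * t) * ((r - 1) / (r + 1)) ^+ (2 * k).
Proof.
move=> a0; rewrite le_eqVlt => /predU1P[<- k0|r1 k0].
  (* For [r = 1] the interval is the point [a], and the tangent line of [t ^- 2] there has residual
     0. *)
  exists ((3 / a ^+ 2)%:P - (2 / a ^+ 3) *: 'X).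
    rewrite (leq_trans (size_polyD _ _))// geq_max size_polyN.
    rewrite (leq_trans (size_polyC_leq1 _)) ?muln_gt0//=.
    by rewrite (leq_trans (size_scale_leq _ _))// size_polyX; lia.
  move=> t; rewrite expr1n mulr1 => /le_anti <-; rewrite subrr mul0r.
  rewrite expr0n muln_eq0 /= eqn0Ngt k0 mulr0.
  rewrite !(hornerD, hornerN, hornerM, horner_exp, hornerC, hornerZ, hornerX).
  rewrite (_ : 1 - _ = 0) ?normr0//; field; exact: lt0r_neq0.
(* [L] maps [a] to 1 and [a * r ^+ 2] to -1; [s] is the positive square root of [L(0)^2 - 1], so
   [L(0) + s] and [L(0) - s] are [rho^-1] and [rho]. *)
pose L : {poly R} := ((r ^+ 2 + 1) / (r ^+ 2 - 1))%:P
   - (2 / (a * (r ^+ 2 - 1))) *: 'X.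
pose s := 2 * r / (r ^+ 2 - 1).
have r21 : 0 < r ^+ 2 - 1 by nra.
have r21' : r ^+ 2 - 1 != 0 by exact: lt0r_neq0.
have a0' : a != 0 by exact: lt0r_neq0.
have r0' : r != 0 by apply: lt0r_neq0; lra.
have r1' : r - 1 != 0 by apply: lt0r_neq0; lra.
have rp1' : r + 1 != 0 by apply: lt0r_neq0; lra.
have s0 : 0 < s by rewrite /s divr_gt0//; lra.
have L0 : L.[0] = (r ^+ 2 + 1) / (r ^+ 2 - 1).
  by rewrite !(hornerD, hornerN, hornerM, horner_exp, hornerC, hornerZ, hornerX)
    mulr0 subr0.
have sE : s ^+ 2 = L.[0] ^+ 2 - 1 by rewrite L0 /s; field.
have sL : (size L <= 2)%N.
  rewrite (leq_trans (size_polyD _ _))// geq_max size_polyN.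
  rewrite (leq_trans (size_polyC_leq1 _))//=.
  by rewrite (leq_trans (size_scale_leq _ _))// size_polyX.
pose m := (2 * k)%N; set rho := (r - 1) / (r + 1).
have rho0 : 0 < rho by rewrite divr_gt0//; lra.
have [sT _] := size_cheb L m sL.
have [E1 E2] := cheb_eval L m 0 s sE.
have [dT _] := cheb_deriv L m.
have bT x := cheb_abs_le1 L m x.
move: sT E1 E2 dT bT; case: (cheb L m) => t u /= sT E1 E2 dT bT.
have Lps : L.[0] + s = rho^-1.
  by rewrite L0 /s /rho; field; rewrite r21' r1' rp1'.
have Lms : L.[0] - s = rho.
  by rewrite L0 /s /rho; field; rewrite r21' rp1'.
rewrite Lps in E1; rewrite Lms in E2.
have rm0 : 0 < rho ^+ m by rewrite exprn_gt0.
have rmV : 0 < rho^-1 ^+ m by rewrite exprn_gt0// invr_gt0.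
have rle1 : rho ^+ m <= 1.
  apply: exprn_ile1; first exact: ltW.
  by rewrite /rho ler_pdivrMr; lra.
have rmE : rho^-1 ^+ m * rho ^+ m = 1.
  by rewrite -exprMn mulVf ?expr1n// gt_eqF.
have T0 : 0 < t.[0] by lra.
have U0 : 0 <= u.[0].
  have : 0 <= s * u.[0]; last by rewrite pmulr_rge0.
  have : rho ^+ m <= rho^-1 ^+ m by nra.
  by lra.
have T2 : rho^-1 ^+ m <= 2 * t.[0] by lra.
have sU : s * u.[0] <= t.[0] by lra.
pose c0 := - t^`().[0] / t.[0].
have c0E : c0 = 2 * m%:R / (a * (r ^+ 2 - 1)) * (u.[0] / t.[0]).
  rewrite /c0 dT hornerMn hornerM /L !derivE
    !(hornerD, hornerN, hornerM, horner_exp, hornerC, hornerZ, hornerX) -mulr_natr.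
  by field; rewrite a0' r21' lt0r_neq0.
have c00 : 0 <= c0.
  by rewrite c0E !mulr_ge0// ?ltW ?invr_gt0// ?mulr_gt0.
(* Since [t(0) - s u(0) = rho ^+ m] is positive, [u(0) / t(0)] is at most [s^-1]. *)
have c0le : c0 <= 2 * k%:R * r / (a * r ^+ 2).
  have -> : 2 * k%:R * r / (a * r ^+ 2) = 2 * m%:R / (a * (r ^+ 2 - 1)) * s^-1.
    by rewrite /s /m natrM; field; rewrite a0' r21' r0'.
  rewrite c0E ler_wpM2l//.
    by rewrite divr_ge0// ?mulr_ge0// ltW// mulr_gt0.
  by rewrite ler_pdivrMr// mulrC -ler_pdivrMr ?invr_gt0// invrK mulrC.
(* By the choice of [c0], [1 - q] vanishes to order 2 at 0. It has degree at most [2 * k + 1], so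
   its quotient [p] by ['X^2] has size at most [2 * k]. *)
pose q : {poly R} := (1 + c0 *: 'X) * (t.[0]^-1 *: t).
have q0 : root (1 - q) 0.
  rewrite rootE !(hornerD, hornerN, hornerM, horner_exp, hornerC, hornerZ, hornerX).
  by apply/eqP; field; rewrite lt0r_neq0.
have /factor_theorem[p1 p1E] := q0; rewrite subr0 in p1E.
have p10 : root p1 0.
  have /(congr1 (fun p => p^`().[0])) := p1E.
  rewrite derivM derivX hornerD !hornerM hornerX hornerC mulr0 add0r mulr1.
  rewrite rootE => <-; rewrite /q /c0 !derivE.
  rewrite !(hornerD, hornerN, hornerM, horner_exp, hornerC, hornerZ, hornerX).
  by apply/eqP; field; rewrite lt0r_neq0.
have /factor_theorem[p pE] := p10; rewrite subr0 in pE.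
exists p.
  have [->|p0] := eqVneq p 0; first by rewrite size_poly0.
  have p1n0 : p1 != 0 by rewrite pE mulf_neq0// polyX_eq0.
  have : (size (1 - q)%R <= m.+2)%N.
    rewrite (leq_trans (size_polyD _ _))// geq_max size_poly1 size_polyN /=.
    rewrite (leq_trans (size_polyMleq _ _))//.
    have : (size (1 + c0 *: 'X : {poly R})%R <= 2)%N.
      rewrite (leq_trans (size_polyD _ _))// geq_max size_poly1/=.
      by rewrite (leq_trans (size_scale_leq _ _))// size_polyX.
    have arith x y z l : (y <= x -> x <= l.+1 -> z <= 2 ->
      (z + y).-1 <= l.+2)%N by clear; lia.
    exact: arith (size_scale_leq _ _) sT.
  by rewrite p1E size_mulX// pE size_mulX// !ltnS.
move=> x /andP[ax xb].
have x0 : 0 < x by lra.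
have -> : 1 - x ^+ 2 * p.[x] = q.[x].
  have -> : x ^+ 2 * p.[x] = (p1 * 'X).[x].
    by rewrite pE !hornerM hornerX; ring.
  by rewrite -p1E hornerD hornerN hornerC subKr.
have Lx : `|L.[x]| <= 1.
  have -> : L.[x] = (a * (r ^+ 2 + 1) - 2 * x) / (a * (r ^+ 2 - 1)).
    rewrite !(hornerD, hornerN, hornerM, horner_exp, hornerC, hornerZ, hornerX).
    by field; rewrite a0' r21'.
  rewrite normrM normfV [X in _ / X]gtr0_norm ?mulr_gt0//.
  rewrite ler_pdivrMr ?mulr_gt0// mul1r ler_norml; apply/andP; split; lra.
have tx := bT x Lx.
(* [2 t(0) = rho^m + rho^-m] is at least [rho^-m], whence the factor 2 of the bound. *)
have T0V : t.[0]^-1 <= 2 * rho ^+ m.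
  rewrite -div1r ler_pdivrMr//; nra.
have c1 : 0 <= 1 + c0 * x by nra.
rewrite !(hornerD, hornerN, hornerM, horner_exp, hornerC, hornerZ, hornerX).
rewrite !normrM normfV.
rewrite (ger0_norm c1) (gtr0_norm T0).
set c := 2 * k%:R * r / (a * r ^+ 2) in c0le *.
have -> : 2 * (1 + c * x) * rho ^+ (2 * k) = (1 + c * x) * (2 * rho ^+ m).
  by rewrite -/m; ring.
apply: ler_pM => //.
- by rewrite mulr_ge0// invr_ge0 ltW.
- by rewrite lerD2l ler_wpM2r// ltW.
apply: le_trans T0V; apply: ler_piMr => //.
by rewrite invr_ge0 ltW.
Qed.

(** * The Euclidean norm *)

Lemma vnorm_sqr {R : realType} {n : nat} (v : 'cV[R]_n) :
  vnorm v ^+ 2 = (v^T *m v) 0 0.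
Proof.
rewrite sqr_sqrtr; last by apply: sumr_ge0 => i _; rewrite sqr_ge0.
by rewrite mxE; apply: eq_bigr => i _; rewrite mxE expr2.
Qed.

Lemma vnorm_ge0 {R : realType} {n : nat} (v : 'cV[R]_n) : 0 <= vnorm v.
Proof. exact: sqrtr_ge0. Qed.

Lemma vnorm_eq0 {R : realType} {n : nat} (v : 'cV[R]_n) :
  (vnorm v == 0) = (v == 0).
Proof.
apply/eqP/eqP => [v0|->]; last first.
  by rewrite /vnorm big1 ?sqrtr0// => i _; rewrite mxE expr0n.
have /eqP : \sum_(i < n) v i 0 ^+ 2 = 0.
  have := vnorm_sqr v; rewrite v0 expr0n mxE => /= E; rewrite [RHS]E.
  by apply: eq_bigr => i _; rewrite mxE expr2.
rewrite psumr_eq0 => [/allP v00|i _]; last exact: sqr_ge0.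
apply/colP => i; rewrite mxE; apply/eqP; rewrite -sqrf_eq0.
exact: v00 (mem_index_enum _).
Qed.

Lemma vnormZ {R : realType} {n : nat} (c : R) (v : 'cV[R]_n) :
  vnorm (c *: v) = `|c| * vnorm v.
Proof.
apply/eqP; rewrite -(@eqrXn2 _ 2) ?mulr_ge0 ?vnorm_ge0//.
rewrite exprMn real_normK ?num_real// !vnorm_sqr !linearZ /= -scalemxAl.
by move: (v^T *m v) => M; rewrite !mxE mulrA expr2.
Qed.

Lemma cauchy_schwarz {R : realType} {n : nat} (u v : 'cV[R]_n) :
  (u^T *m v) 0 0 <= vnorm u * vnorm v.
Proof.
have [/eqP|u0] := eqVneq (vnorm u) 0.
  by rewrite vnorm_eq0 => /eqP ->; rewrite linear0 mul0mx mxE mulr_ge0 ?vnorm_ge0.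
have [/eqP|v0] := eqVneq (vnorm v) 0.
  by rewrite vnorm_eq0 => /eqP ->; rewrite mulmx0 mxE mulr_ge0 ?vnorm_ge0.
have uv0 : 0 < vnorm u * vnorm v.
  by rewrite mulr_gt0// lt_neqAle eq_sym ?u0 ?v0 vnorm_ge0.
have := sqr_ge0 (vnorm (vnorm v *: u - vnorm u *: v)); rewrite vnorm_sqr.
have vu : (v^T *m u) 0 0 = (u^T *m v) 0 0.
  by rewrite -[v^T *m u]trmxK trmx_mul trmxK mxE.
rewrite mulmxBr [(_ - _)^T]linearB /= !mulmxBl !linearZ /= -!scalemxAl.
have := vnorm_sqr u; have := vnorm_sqr v; move: vu uv0.
move: (v^T *m u) (u^T *m v) (u^T *m u) (v^T *m v) => X Y Z T.
move: (vnorm u) (vnorm v) => a b XY ab Tb Za.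
rewrite !mxE XY -Tb -Za => E.
have : 0 <= (a * b) * (a * b - Y 0 0) by lra.
by rewrite pmulr_rge0// subr_ge0.
Qed.

(** * Krylov compression as Gauss quadrature *)

Lemma horner_mx_sum {R : realType} {n : nat} (B : 'M[R]_n.+1) (p : {poly R}) :
  horner_mx B p = \sum_(i < size p) p`_i *: B ^+ i.
Proof.
rewrite -{1}[p]coefK poly_def linear_sum; apply: eq_bigr => i _.
by rewrite linearZ /= rmorphXn /= horner_mx_X.
Qed.

(** [Q] carries [S ^+ j *m e] to [B ^+ j *m g] for [j <= k]. A power up to [2 * k + 1] splits into
    two such powers around one factor [B], which [Q] compresses to [S]. *)
Lemma krylov_gauss {R : realType} {n k : nat} (B : 'M[R]_n.+1)
    (Q : 'M[R]_(n.+1, k.+1)) (g : 'cV[R]_n.+1) (e : 'cV[R]_k.+1) :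
  B^T = B -> Q^T *m Q = 1%:M -> Q *m e = g ->
  (forall j, (j <= k)%N -> Q *m Q^T *m (B ^+ j *m g) = B ^+ j *m g) ->
  forall p : {poly R}, (size p <= 2 * k.+1)%N ->
  (e^T *m horner_mx (Q^T *m B *m Q) p *m e) 0 0 =
  (g^T *m horner_mx B p *m g) 0 0.
Proof.
move=> Bs QQ Qe kry p sp; set S := Q^T *m B *m Q.
have BQ j : (j <= k)%N -> Q *m (S ^+ j *m e) = B ^+ j *m g.
  elim: j => [|j IH] jk; first by rewrite !expr0 !mul1mx.
  rewrite [S ^+ j.+1]exprS -[_ * _]/(_ *m _) {1}/S.
  have := kry _ jk; rewrite exprS -[_ * _]/(_ *m _) => <-.
  by rewrite -!mulmxA IH// ltnW.
have Ss : S^T = S by rewrite /S !trmx_mul trmxK Bs mulmxA.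
have trX m (M : 'M[R]_m.+1) i : M^T = M -> (M ^+ i)^T = M ^+ i.
  move=> Ms; elim: i => [|i IH]; first by rewrite expr0 trmx1.
  by rewrite exprS [LHS]trmx_mul IH Ms -[LHS]/(_ * _) -exprSr exprS.
have mom i : (i < 2 * k.+1)%N -> e^T *m S ^+ i *m e = g^T *m B ^+ i *m g.
  case: i => [_|i ik].
    by rewrite !expr0 !mulmx1 -Qe trmx_mul -mulmxA [Q^T *m _]mulmxA QQ mul1mx.
  pose j := minn k i; pose l := (i - j)%N.
  have jk : (j <= k)%N by rewrite geq_minl.
  have lk : (l <= k)%N by rewrite /l /j; clear -ik; lia.
  have -> : i.+1 = (j + l.+1)%N by rewrite /l /j; clear -ik; lia.
  rewrite !exprD ![_ ^+ l.+1]exprS -![_ * _]/(_ *m _).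
  have -> : g^T *m (B ^+ j *m (B *m B ^+ l)) *m g
     = (B ^+ j *m g)^T *m B *m (B ^+ l *m g).
    by rewrite trmx_mul trX// !mulmxA.
  by rewrite -!BQ// !trmx_mul trX// /S !mulmxA.
rewrite !horner_mx_sum !mulmx_sumr !mulmx_suml !summxE; apply: eq_bigr => i _.
rewrite -!scalemxAr -!scalemxAl mom ?[LHS]mxE ?[RHS]mxE//.
exact: leq_trans (ltn_ord i) sp.
Qed.

(** * Rayleigh quotients, the secular function and the quadrature error *)

Lemma rayleigh_bounds {R : realType} {n : nat} (B : 'M[R]_n.+1) (a b : R) :
  B^T = B -> (forall d, eigenvalue B d -> a <= d <= b) ->
  forall v : 'cV[R]_n.+1,
  a * (v^T *m v) 0 0 <= (v^T *m B *m v) 0 0 <= b * (v^T *m v) 0 0.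
Proof.
move=> Bs eB v; have [D DB /(_ v)[W W0 E]] := spectral_measure B Bs.
have := E 'X; rewrite horner_mx_X => ->.
have := E 1; rewrite rmorph1 mulmx1 => ->.
rewrite !mulr_sumr; apply/andP; split; apply: ler_sum => i _;
  by rewrite hornerX hornerC mul1r ler_wpM2r//; case/andP: (eB _ (DB i)).
Qed.

Lemma eigenvalue_rayleigh {R : realType} {n : nat} (B : 'M[R]_n) (d : R) :
  eigenvalue B d -> exists2 v : 'cV[R]_n, 0 < (v^T *m v) 0 0 &
  (v^T *m B *m v) 0 0 = d * (v^T *m v) 0 0.
Proof.
case/eigenvalueP=> v vB v0; exists v^T; last first.
  by rewrite trmxK vB -scalemxAl mxE.
by rewrite -vnorm_sqr exprn_gt0// lt_neqAle vnorm_ge0 eq_sym vnorm_eq0 trmx_eq0 v0.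
Qed.

(* Tangent inequality for the convex secular function
   [lambda |-> e^T (S - d + lambda)^-2 e] at [lambda = d], read off the
   spectral measure of [h]; no invertibility of [S - d] is needed. *)
Lemma secular_tangent {R : realType} {n : nat} (S : 'M[R]_n.+1) (d : R)
    (h e : 'cV[R]_n.+1) (Si := invmx S) :
  S^T = S -> 0 <= d -> (forall t, eigenvalue S t -> 0 < t /\ d <= t) ->
  e = - ((S - d%:M) *m h) ->
  2 * d * (e^T *m (Si *m Si *m Si) *m e) 0 0 <=
  (h^T *m h) 0 0 - (e^T *m (Si *m Si) *m e) 0 0.
Proof.
move=> Ss d0 eS eE.
have [D DS /(_ h)[W W0 E]] := spectral_measure S Ss.
have [|_ [psi psiE psiD]] := invmx_poly S.
  by apply/negP => /eS[]; rewrite ltxx.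
have Pe : horner_mx S ('X - d%:P) = S - d%:M.
  by rewrite rmorphB /= horner_mx_X horner_mx_C.
have Ps : (S - d%:M)^T = S - d%:M by rewrite linearB /= Ss tr_scalar_mx.
have eF q : (e^T *m horner_mx S q *m e) 0 0 =
    \sum_i (('X - d%:P) * q * ('X - d%:P)).[D i] * W i.
  rewrite -E !rmorphM /= Pe eE [(- _)^T]linearN /= trmx_mul Ps.
  by rewrite mulmxN !mulNmx opprK -![_ * _]/(_ *m _) !mulmxA.
have -> : Si *m Si *m Si = horner_mx S (psi * psi * psi).
  by rewrite !rmorphM /= psiE.
have -> : Si *m Si = horner_mx S (psi * psi) by rewrite !rmorphM /= psiE.
rewrite !eF; have := E 1; rewrite rmorph1 mulmx1 => ->.
rewrite -sumrB mulr_sumr; apply: ler_sum => i _.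
have [Di0 dDi] := eS _ (DS i).
rewrite !(hornerD, hornerN, hornerM, hornerC, hornerX) psiD//.
move: (D i) (W i) Di0 dDi (W0 i) => t w t0 dt w0.
(* The difference of the integrands has numerator [d^2 (3t - 2d)], nonnegative because [d <= t]. *)
rewrite -subr_ge0.
have -> : 1 * w - (t - d) * (t^-1 * t^-1) * (t - d) * w -
  2 * d * ((t - d) * (t^-1 * t^-1 * t^-1) * (t - d) * w)
  = d ^+ 2 * (t + 2 * (t - d)) * w / t ^+ 3.
  by field; rewrite gt_eqF.
by rewrite !mulr_ge0// ?sqr_ge0// ?invr_ge0 ?exprn_ge0 ?ltW//; lra.
Qed.

(** Both measures integrate the [p] of [cheb_residual] alike, so the difference is the sum of two
    approximation errors. Bounding the moments at the nodes by those of [B] makes the two bounds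
    equal, and 2 becomes 4. *)
Lemma gauss_remainder {R : realType} {n k : nat} (B : 'M[R]_n.+1)
    (S : 'M[R]_k.+1) (g : 'cV[R]_n.+1) (e : 'cV[R]_k.+1) (a r : R)
    (Bi := invmx B) (Si := invmx S) :
  B^T = B -> S^T = S -> 0 < a -> 1 <= r ->
  (forall d, eigenvalue B d -> a <= d <= a * r ^+ 2) ->
  (forall d, eigenvalue S d -> a <= d <= a * r ^+ 2) ->
  (forall p : {poly R}, (size p <= 2 * k.+1)%N ->
     (e^T *m horner_mx S p *m e) 0 0 = (g^T *m horner_mx B p *m g) 0 0) ->
  (g^T *m (Bi *m Bi) *m g) 0 0 - (e^T *m (Si *m Si) *m e) 0 0 <=
  4 * ((g^T *m (Bi *m Bi) *m g) 0 0
       + 2 * k.+1%:R * r / (a * r ^+ 2) * (g^T *m Bi *m g) 0 0)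
    * ((r - 1) / (r + 1)) ^+ (2 * k.+1).
Proof.
move=> Bs Ss a0 r1 eB eS quad.
have [D DB /(_ g)[W W0 EW]] := spectral_measure B Bs.
have [th thS /(_ e)[w w0 Ew]] := spectral_measure S Ss.
have Dab i := eB _ (DB i); have tab i := eS _ (thS i).
have D0 i : 0 < D i by apply: lt_le_trans a0 _; case/andP: (Dab i).
have t0 i : 0 < th i by apply: lt_le_trans a0 _; case/andP: (tab i).
have nB : ~~ eigenvalue B 0.
  by apply/negP => /eB; rewrite leNgt a0.
have nS : ~~ eigenvalue S 0.
  by apply/negP => /eS; rewrite leNgt a0.
have [_ [psi psiE psiD]] := invmx_poly B nB.
have [_ [phi phiE phiD]] := invmx_poly S nS.
have G1E : (g^T *m Bi *m g) 0 0 = \sum_i D i ^- 1 * W i.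
  rewrite /Bi -psiE EW; apply: eq_bigr => i _; by rewrite psiD// expr1.
have G2E : (g^T *m (Bi *m Bi) *m g) 0 0 = \sum_i D i ^- 2 * W i.
  have -> : Bi *m Bi = horner_mx B (psi ^+ 2) by rewrite rmorphXn /= psiE.
  by rewrite EW; apply: eq_bigr => i _; rewrite horner_exp psiD// exprVn.
have E2E : (e^T *m (Si *m Si) *m e) 0 0 = \sum_i th i ^- 2 * w i.
  have -> : Si *m Si = horner_mx S (phi ^+ 2) by rewrite rmorphXn /= phiE.
  by rewrite Ew; apply: eq_bigr => i _; rewrite horner_exp phiD// exprVn.
have quad' (p : {poly R}) : (size p <= 2 * k.+1)%N ->
    \sum_i p.[th i] * w i = \sum_i p.[D i] * W i.
  by move=> sp; rewrite -Ew -EW quad.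
have mom m : (0 < m)%N -> \sum_i th i ^- m * w i <= \sum_i D i ^- m * W i.
  by move=> m0; apply: moment_inverse_le => // p; rewrite card_ord; exact: quad'.
have [p sp pP] := cheb_residual a r k.+1 a0 r1 isT.
set c := 2 * _ * r / _ in pP *; set rho := (_ / _) ^+ _ in pP *.
have c0 : 0 <= c.
  by rewrite /c divr_ge0 ?mulr_ge0 ?exprn_ge0// ?ltW// (lt_le_trans ltr01).
have rho0 : 0 <= rho by rewrite /rho exprM exprn_ge0// sqr_ge0.
have pt t : a <= t <= a * r ^+ 2 ->
    `|t ^- 2 - p.[t]| <= 2 * rho * (t ^- 2 + c * t ^- 1).
  move=> tI; have tp : 0 < t by apply: lt_le_trans a0 _; case/andP: tI.
  have -> : t ^- 2 - p.[t] = t ^- 2 * (1 - t ^+ 2 * p.[t]).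
    by field; rewrite gt_eqF.
  rewrite normrM ger0_norm ?invr_ge0 ?sqr_ge0//.
  have -> : 2 * rho * (t ^- 2 + c * t ^- 1) = t ^- 2 * (2 * (1 + c * t) * rho).
    by rewrite expr1; field; rewrite gt_eqF.
  by rewrite ler_wpM2l ?pP// invr_ge0 sqr_ge0.
have UB : \sum_i D i ^- 2 * W i - \sum_i p.[D i] * W i <=
   2 * rho * (\sum_i D i ^- 2 * W i + c * \sum_i D i ^- 1 * W i).
  rewrite -sumrB mulr_sumr -big_split mulr_sumr; apply: ler_sum => i _ /=.
  rewrite -mulrBl mulrA -mulrDl mulrA ler_wpM2r//.
  exact: le_trans (ler_norm _) (pt _ (Dab i)).
have UE : \sum_i p.[th i] * w i - \sum_i th i ^- 2 * w i <=
   2 * rho * (\sum_i th i ^- 2 * w i + c * \sum_i th i ^- 1 * w i).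
  rewrite -sumrB mulr_sumr -big_split mulr_sumr; apply: ler_sum => i _ /=.
  rewrite -mulrBl mulrA -mulrDl mulrA ler_wpM2r//.
  by apply: le_trans (ler_norm _) _; rewrite distrC; exact: pt.
rewrite G1E G2E E2E; move: UB UE (mom 1%N isT) (mom 2%N isT).
rewrite (quad' _ sp).
move: (\sum_i D i ^- 2 * W i) (\sum_i D i ^- 1 * W i) => G2 G1.
move: (\sum_i th i ^- 2 * w i) (\sum_i th i ^- 1 * w i) => E2 E1.
move: (\sum_i _) => P UB UE l1 l2.
have : 2 * rho * (E2 + c * E1) <= 2 * rho * (G2 + c * G1).
  by rewrite ler_wpM2l ?mulr_ge0// lerD// ler_wpM2l.
by clear -UB UE; lra.
Qed.

(** A zero value would annihilate every weight, and the weights sum to the squared norm of [e]. *)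
Lemma inv_cube_form_gt0 {R : realType} {n : nat} (S : 'M[R]_n.+1)
    (e : 'cV[R]_n.+1) (Si := invmx S) :
  S^T = S -> (forall d, eigenvalue S d -> 0 < d) -> e != 0 ->
  0 < (e^T *m (Si *m Si *m Si) *m e) 0 0.
Proof.
move=> Ss eS e0; have [th thS /(_ e)[w w0 Ew]] := spectral_measure S Ss.
have nS : ~~ eigenvalue S 0 by apply/negP => /eS; rewrite ltxx.
have [_ [phi phiE phiD]] := invmx_poly S nS.
have -> : Si *m Si *m Si = horner_mx S (phi ^+ 3).
  by rewrite rmorphXn /= phiE [_ ^+ 3]exprSr expr2.
have t0 i := eS _ (thS i).
have pos i : 0 <= (phi ^+ 3).[th i] * w i.
  by rewrite horner_exp phiD// mulr_ge0// exprn_ge0// invr_ge0 ltW.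
rewrite Ew lt_neqAle sumr_ge0// andbT eq_sym; apply: contra_neqN e0 => /eqP.
move=> /psumr_eq0P => w00; apply/eqP; rewrite -vnorm_eq0 -sqrf_eq0 vnorm_sqr.
have := Ew 1; rewrite rmorph1 mulmx1 => ->; rewrite big1// => i _.
have /eqP := w00 (fun i _ => pos i) i isT.
rewrite horner_exp phiD// mulf_eq0 expf_eq0 /= invr_eq0 gt_eqF//= => /eqP ->.
by rewrite mulr0.
Qed.

(** * Shifted Krylov spaces, the spectral norm and eigenvectors of [Mmat] *)

Lemma krylov_rows_fix {R : realType} {n k : nat} (A : 'M[R]_n) (g : 'cV[R]_n)
    (Q : 'M[R]_(n, k)) : Q^T *m Q = 1%:M ->
  (krylov_rows k k A g <= first_cols k Q)%MS ->
  forall j, (j < k)%N -> Q *m Q^T *m (A ^+ j *m g) = A ^+ j *m g.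
Proof.
move=> QQ /row_subP sub j jk; have := sub (Ordinal jk).
rewrite rowK /= jk.
have -> : first_cols k Q = Q^T.
  by apply/row_matrixP => i; rewrite rowK ltn_ord.
case/submxP=> c /(congr1 trmx); rewrite trmxK trmx_mul trmxK => ->.
by rewrite mulmxA -[Q *m _ *m Q]mulmxA QQ mulmx1.
Qed.

(** Krylov spaces are invariant under shifts of the matrix. The induction on [j] trades powers of
    the shifted matrix for powers of [A], so it is run on mixed products with [i + j <= k]. *)
Lemma krylov_shift {R : realType} {n k : nat} (A P : 'M[R]_n.+1)
    (g : 'cV[R]_n.+1) (l : R) :
  (forall j, (j <= k)%N -> P *m (A ^+ j *m g) = A ^+ j *m g) ->
  forall j, (j <= k)%N ->
  P *m ((A + l%:M) ^+ j *m g) = (A + l%:M) ^+ j *m g.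
Proof.
move=> PA j jk.
suff H i : (i + j <= k)%N -> P *m ((A + l%:M) ^+ j *m (A ^+ i *m g)) =
    (A + l%:M) ^+ j *m (A ^+ i *m g).
  by have := H 0%N jk; rewrite expr0 mul1mx.
elim: j i {jk} => [|j IH] i ik; first by rewrite expr0 mul1mx PA// -(addn0 i).
have E : (A + l%:M) ^+ j.+1 *m (A ^+ i *m g) =
   (A + l%:M) ^+ j *m (A ^+ i.+1 *m g) + l *: ((A + l%:M) ^+ j *m (A ^+ i *m g)).
  rewrite exprSr exprS -![_ * _]/(_ *m _) mulmxDr mulmxDl mul_mx_scalar.
  by rewrite -scalemxAl !mulmxA.
rewrite E mulmxDr -scalemxAr !IH//; last by rewrite addSnnS.
by rewrite (leq_trans _ ik)// leq_add2l.
Qed.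

Lemma vnorm_mul_le {R : realType} {n : nat} (B : 'M[R]_n.+1) (b : R) :
  B^T = B -> 0 <= b -> (forall d, eigenvalue B d -> 0 <= d <= b) ->
  forall v, vnorm (B *m v) <= b * vnorm v.
Proof.
move=> Bs b0 eB v; have [D DB /(_ v)[W W0 EW]] := spectral_measure B Bs.
rewrite -(@ler_pXn2r _ 2) ?nnegrE ?mulr_ge0 ?vnorm_ge0//.
rewrite exprMn !vnorm_sqr trmx_mul Bs mulmxA -[_ *m B *m B]mulmxA.
have -> : B *m B = horner_mx B ('X ^+ 2) by rewrite rmorphXn /= horner_mx_X.
have := EW 1; rewrite rmorph1 mulmx1 => ->; rewrite EW mulr_sumr.
apply: ler_sum => i _; rewrite hornerC mul1r horner_exp hornerX ler_wpM2r//.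
by have /andP[? ?] := eB _ (DB i); rewrite ler_pXn2r.
Qed.

(** The bound [b] makes the set nonempty and bounded above, so that [sup] is a genuine supremum. *)
Lemma mxnorm_bounds {R : realType} {m n : nat} (B : 'M[R]_(m, n)) (b : R) :
  0 <= b -> (forall v, vnorm (B *m v) <= b * vnorm v) ->
  mxnorm B <= b /\ forall v, vnorm v <= 1 -> vnorm (B *m v) <= mxnorm B.
Proof.
move=> b0 Bb.
pose E : set R := [set vnorm (B *m v) | v in [set v : 'cV[R]_n | vnorm v <= 1]]%classic.
have ubE : ubound E b.
  by move=> _ [v v1 <-]; rewrite (le_trans (Bb v))// ler_piMr.
split.
  apply: ge_sup => //; exists (vnorm (B *m 0)); exists 0 => //=.
  by have /eqP -> : vnorm (0 : 'cV[R]_n) == 0 by rewrite vnorm_eq0.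
move=> v v1; apply: ub_le_sup; first by exists b.
by exists v.
Qed.

Lemma Mmat_eigenvector {R : realType} {n : nat} (A : 'M[R]_n) (g : 'cV[R]_n)
    (Delta l : R) (y : 'cV[R]_(n + n)) :
  Mmat A g Delta *m y = l *: y ->
  usubmx y = (A + l%:M) *m dsubmx y /\
  exists c, (A + l%:M) *m usubmx y = c *: g.
Proof.
rewrite -{1 2}(vsubmxK y) /Mmat mul_block_col scale_col_mx => /eq_col_mx[E1 E2].
split; first by rewrite mulmxDl mul_scalar_mx -E2 mul1mx mulNmx addrC subrK.
exists ((Delta ^+ 2)^-1 * (g^T *m dsubmx y) 0 0).
rewrite mulmxDl mul_scalar_mx -E1 mulNmx addrA subrr add0r -scalemxAl -mulmxA.
by rewrite [X in g *m X]mx11_scalar mul_mx_scalar scalerA.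
Qed.

(** * From the quadrature error to the gap between the multipliers *)

Theorem theorem5p9 (R : realType) (n : nat) (A : 'M[R]_n) (g : 'cV[R]_n)
  (Delta : R) (alpha1 alphan : R) (xopt : 'cV[R]_n) (lamopt : R)
  (k : nat) (Q : 'M[R]_(n, k)) (T : 'M[R]_k) (h : 'cV[R]_k) (lamk : R)
  (y : 'cV[R]_(n + n)) :
  (* A symmetric, g nonzero, Delta > 0 *)
  A^T = A -> g != 0 -> 0 < Delta ->
  (* alpha1 / alphan: largest / smallest eigenvalue of A *)
  eigenvalue A alpha1 -> (forall a, eigenvalue A a -> a <= alpha1) ->
  eigenvalue A alphan -> (forall a, eigenvalue A a -> alphan <= a) ->
  (* xopt: global minimizer of the TRS with multiplier lamopt *)
  vnorm xopt <= Delta ->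
  (forall x : 'cV[R]_n, vnorm x <= Delta -> trs_obj A g xopt <= trs_obj A g x) ->
  0 <= lamopt ->
  (A + lamopt%:M) *m xopt = - g ->
  lamopt * (Delta - vnorm xopt) = 0 ->
  psd (A + lamopt%:M) ->
  (* easy case *)
  - alphan < lamopt ->
  (* Lanczos: k in {1,...,kmax}, Q_k orthonormal with nested Krylov spans *)
  (1 <= k)%N ->
  \rank (krylov_rows k k A g) = k ->
  Q^T *m Q = 1%:M ->
  Q *m e1 R k = (vnorm g)^-1 *: g ->
  (forall j : nat, (j <= k)%N -> (first_cols j Q == krylov_rows k j A g)%MS) ->
  T = Q^T *m A *m Q ->
  (* GLTR iterate x_k = Q_k h_k with multiplier lamk *)
  vnorm h <= Delta ->
  (forall h' : 'cV[R]_k, vnorm h' <= Delta ->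
     2^-1 * (h^T *m T *m h) 0 0 + vnorm g * (h^T *m e1 R k) 0 0
     <= 2^-1 * (h'^T *m T *m h') 0 0 + vnorm g * (h'^T *m e1 R k) 0 0) ->
  0 <= lamk ->
  (T + lamk%:M) *m h = - (vnorm g *: e1 R k) ->
  lamk * (Delta - vnorm h) = 0 ->
  psd (T + lamk%:M) ->
  (* boundary assumptions *)
  vnorm xopt = Delta -> vnorm (Q *m h) = Delta ->
  (* y unit eigenvector of M for lamopt *)
  vnorm y = 1 -> Mmat A g Delta *m y = lamopt *: y ->
  let Aopt := A + lamopt%:M in
  let kappa := (alpha1 + lamopt) / (alphan + lamopt) in
  let y1 := usubmx y in let y2 := dsubmx y in
  let Tinv := invmx (T + lamopt%:M) in
  let sk := vnorm (invmx Aopt *m xopt) /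
            (vnorm g * ((e1 R k)^T *m (Tinv *m Tinv *m Tinv) *m e1 R k) 0 0) in
  lamopt - lamk <=
    2 * sk * (1 + 2 * vnorm y1 * k%:R * Num.sqrt kappa / (vnorm y2 * mxnorm Aopt))
      * ((Num.sqrt kappa - 1) / (Num.sqrt kappa + 1)) ^+ (2 * k).
Proof.
move=> As g0 Dl0 ea1 a1max ean anmin _ _ _ xoptE _ _ easy k0 _ QQ Qe1 kry TE.
move=> _ _ _ hE _ psdT nx nh ny My /=.
(* The polynomial calculus needs matrices of positive size; [g != 0] and [1 <= k] exclude the empty
   ones. *)
destruct n as [|n]; first by rewrite [g]flatmx0 eqxx in g0.
destruct k as [|k]; first by [].
set B := A + lamopt%:M; set S := T + lamopt%:M.
set a := alphan + lamopt; set b := alpha1 + lamopt.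
set r := Num.sqrt (b / a).
have a0 : 0 < a by rewrite /a addrC -ltrBlDr sub0r.
have ab : a <= b by rewrite lerD2r a1max.
have b0 : 0 < b := lt_le_trans a0 ab.
have r2 : r ^+ 2 = b / a by rewrite sqr_sqrtr// divr_ge0 ?ltW.
have bE : b = a * r ^+ 2 by rewrite r2 mulrC divfK// gt_eqF.
have r1 : 1 <= r by rewrite -[1]sqrtr1 ler_wsqrtr// ler_pdivlMr// mul1r.
have Bs : B^T = B by rewrite linearD /= As tr_scalar_mx.
have SE : S = Q^T *m B *m Q.
  by rewrite /S TE /B mulmxDr mulmxDl mul_mx_scalar -scalemxAl QQ scalemx1.
have Ss : S^T = S by rewrite SE !trmx_mul trmxK Bs mulmxA.
have eB d : eigenvalue B d -> a <= d <= b.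
  case/eigenvalueP=> v vB v0.
  have vA : eigenvalue A (d - lamopt).
    apply/eigenvalueP; exists v => //.
    have -> : A = B - lamopt%:M by rewrite addrK.
    by rewrite mulmxBr vB mul_mx_scalar scalerBl.
  by rewrite -lerBrDr anmin// -lerBlDr a1max.
(* An eigenvector [v] of the compression [S] has the same Rayleigh quotient as [Q *m v] has for
   [B]. *)
have eS d : eigenvalue S d -> a <= d <= b.
  case/eigenvalue_rayleigh=> v v0 E.
  have QvE : (v^T *m S *m v) = (Q *m v)^T *m B *m (Q *m v).
    by rewrite SE trmx_mul !mulmxA.
  have vvE : (Q *m v)^T *m (Q *m v) = v^T *m v.
    by rewrite trmx_mul mulmxA -[_ *m Q^T *m Q]mulmxA QQ mulmx1.
  have := rayleigh_bounds B a b Bs eB (Q *m v).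
  by rewrite -QvE vvE E !ler_pM2r.
have ng0 : 0 < vnorm g by rewrite lt_neqAle vnorm_ge0 eq_sym vnorm_eq0 g0.
pose e := vnorm g *: e1 R k.+1.
have Qe : Q *m e = g.
  by rewrite -scalemxAr Qe1 scalerA mulfV ?scale1r// gt_eqF.
have e0 : e != 0 by apply: contraNneq g0 => e0; rewrite -Qe e0 mulmx0.
have quad (p : {poly R}) : (size p <= 2 * k.+1)%N ->
    (e^T *m horner_mx S p *m e) 0 0 = (g^T *m horner_mx B p *m g) 0 0.
  rewrite SE; apply: krylov_gauss => //; apply: krylov_shift => j jk.
  apply: krylov_rows_fix => //.
  by have /andP[] := kry k.+1 (leqnn _).
have [|Bu _] := invmx_poly B; first by apply/negP => /eB; rewrite leNgt a0.
set Bi := invmx B; set Si := invmx S.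
have xE : xopt = - (Bi *m g).
  by rewrite -(mulKmx Bu xopt) xoptE mulmxN.
have Bis : Bi^T = Bi by rewrite /Bi trmx_inv Bs.
set rho := (r - 1) / (r + 1).
set N1 := ((e1 R k.+1)^T *m (Si *m Si *m Si) *m e1 R k.+1) 0 0.
have NE : (e^T *m (Si *m Si *m Si) *m e) 0 0 = vnorm g ^+ 2 * N1.
  rewrite /e [(_ *: _)^T]linearZ /= -!scalemxAl -scalemxAr scalerA.
  by rewrite [LHS]mxE -expr2.
have N0 : 0 < vnorm g ^+ 2 * N1.
  rewrite -NE; apply: inv_cube_form_gt0 => // d /eS/andP[ad _].
  exact: lt_le_trans ad.
have N10 : 0 < N1 by rewrite pmulr_rgt0 ?exprn_gt0 in N0.
have bv := vnorm_mul_le B b Bs (ltW b0).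
have {bv} bv v : vnorm (B *m v) <= b * vnorm v.
  by apply: bv => d /eB/andP[ad ->]; rewrite (le_trans (ltW a0) ad).
have [mu_le mu_ge] := mxnorm_bounds B b (ltW b0) bv.
set mu := mxnorm B in mu_le mu_ge *.
have mu0 : 0 < mu.
  have := mu_ge ((vnorm g)^-1 *: g); rewrite vnormZ normfV (gtr0_norm ng0).
  rewrite mulVf ?gt_eqF//.
  move=> /(_ (lexx _)); apply: lt_le_trans.
  rewrite lt_neqAle vnorm_ge0 eq_sym vnorm_eq0 andbT -scalemxAr scaler_eq0.
  rewrite negb_or invr_eq0 gt_eqF//=; apply: contraNneq g0 => Bg.
  by rewrite -(mulKmx Bu g) Bg mulmx0.
have [y1E [c y1c]] := Mmat_eigenvector A g Delta lamopt y My.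
rewrite -/B in y1E y1c.
have y1x : usubmx y = (- c) *: xopt.
  by rewrite xE scalerN scaleNr opprK scalemxAr -y1c mulKmx.
have y2x : dsubmx y = (- c) *: (Bi *m xopt).
  by rewrite scalemxAr -y1x y1E mulKmx.
(* Otherwise both halves of the unit vector [y] would vanish. *)
have c0 : c != 0.
  apply/eqP => c0; move/eqP: ny; rewrite -[y]vsubmxK y1x y2x c0 oppr0 !scale0r.
  rewrite col_mx0; have /eqP -> : vnorm (0 : 'cV[R]_(n.+1 + n.+1)) == 0.
    by rewrite vnorm_eq0.
  by rewrite eq_sym oner_eq0.
have x0 : 0 < vnorm (Bi *m xopt).
  rewrite lt_neqAle vnorm_ge0 eq_sym vnorm_eq0 andbT; apply: contraNneq g0 => Bx.
  by rewrite -[g]opprK -xoptE -(mulKVmx Bu xopt) -/Bi Bx !mulmx0 oppr0.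
rewrite y1x y2x !vnormZ.
have c0' : 0 < `|- c| by rewrite normrN normr_gt0.
set X := vnorm (Bi *m xopt) in x0 *; set K : R := k.+1%:R.
(* The common factor [c] cancels from the ratio of [y1] and [y2]. *)
have RE : 2 * (X / (vnorm g * N1)) *
   (1 + 2 * (`|- c| * vnorm xopt) * K * r / (`|- c| * X * mu)) * rho ^+ (2 * k.+1)
  = 2 * (X + 2 * K * r / mu * vnorm xopt) * rho ^+ (2 * k.+1) / (vnorm g * N1).
  by field; rewrite !gt_eqF.
rewrite RE.
have rho0 : 0 <= rho ^+ (2 * k.+1) by rewrite exprM exprn_ge0 ?sqr_ge0.
have Kr : 0 <= 2 * K * r by rewrite !mulr_ge0// (le_trans ler01).
(* The tangent inequality needs a nonnegative gap; otherwise nonnegativity of the right-hand side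
   suffices. *)
have [d0|d0] := leP (lamopt - lamk) 0.
  apply: le_trans d0 _; apply: divr_ge0; last by rewrite mulr_ge0 ?ltW.
  apply: mulr_ge0 => //; apply: mulr_ge0 => //; apply: addr_ge0; first exact: ltW.
  by rewrite mulr_ge0 ?vnorm_ge0// divr_ge0// ltW.
(* The boundary assumptions enter here: [h] and [xopt = - B^-1 g] both have norm [Delta]. *)
have hh : (h^T *m h) 0 0 = (g^T *m (Bi *m Bi) *m g) 0 0.
  transitivity (Delta ^+ 2).
    by rewrite -nh vnorm_sqr trmx_mul mulmxA -[_ *m Q^T *m Q]mulmxA QQ mulmx1.
  rewrite -nx vnorm_sqr xE [(- _)^T]linearN /= mulNmx mulmxN opprK trmx_mul Bis.
  by rewrite !mulmxA.
have SdT : S - (lamopt - lamk)%:M = T + lamk%:M.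
  by rewrite /S raddfB /= opprB -addrA [lamopt%:M + _]addrC subrK.
have tang := secular_tangent S (lamopt - lamk) h e Ss (ltW d0).
have {tang} tang : 2 * (lamopt - lamk) * (vnorm g ^+ 2 * N1) <=
   (h^T *m h) 0 0 - (e^T *m (Si *m Si) *m e) 0 0.
  rewrite -NE; apply: tang => [t tS|]; last by rewrite SdT hE opprK.
  have /andP[ta _] := eS _ tS; split; first exact: lt_le_trans ta.
  (* Positive semidefiniteness of [T + lamk], tested on an eigenvector of [S], gives the required
     bound of the gap by [t]. *)
  have [v v0 vE] := eigenvalue_rayleigh S t tS; have := psdT v.
  rewrite -SdT mulmxBr mulmxBl mul_mx_scalar -scalemxAl.
  move: (v^T *m S *m v) (v^T *m v) vE v0 => F G FE G0; rewrite !mxE FE.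
  by rewrite -mulrBl pmulr_lge0// subr_ge0.
rewrite bE in eB eS.
have rem := gauss_remainder B S g e a r Bs Ss a0 r1 eB eS quad.
rewrite -bE -/rho -/Bi -/Si -/K in rem; rewrite hh in tang.
(* Cauchy-Schwarz against [B^-1 xopt] and, in [G1], against [xopt] produces the norms of the final
   bound. *)
have G2 : (g^T *m (Bi *m Bi) *m g) 0 0 <= vnorm g * X.
  have -> : g^T *m (Bi *m Bi) *m g = g^T *m (- (Bi *m xopt)).
    by rewrite xE !mulmxN opprK !mulmxA.
  apply: le_trans (cauchy_schwarz _ _) _.
  by rewrite -scaleN1r vnormZ normrN1 mul1r.
have G1 : (g^T *m Bi *m g) 0 0 <= vnorm g * vnorm xopt.
  have -> : g^T *m Bi *m g = g^T *m (- xopt) by rewrite xE opprK !mulmxA.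
  apply: le_trans (cauchy_schwarz _ _) _.
  by rewrite -scaleN1r vnormZ normrN1 mul1r.
(* The spectral norm [mu] is at most [b], so putting it in the denominator only enlarges the
   bound. *)
have Kb : 2 * K * r / b <= 2 * K * r / mu.
  by rewrite ler_wpM2l// lef_pV2 ?posrE.
have GB : (g^T *m (Bi *m Bi) *m g) 0 0 + 2 * K * r / b * (g^T *m Bi *m g) 0 0
   <= vnorm g * (X + 2 * K * r / mu * vnorm xopt).
  rewrite mulrDr; apply: lerD => //.
  apply: (@le_trans _ _ (2 * K * r / b * (vnorm g * vnorm xopt))).
    by apply: ler_wpM2l => //; rewrite divr_ge0// ltW.
  rewrite mulrCA; apply: ler_wpM2l; first exact: ltW.
  by apply: ler_wpM2r => //; exact: vnorm_ge0.
rewrite ler_pdivlMr ?mulr_gt0//.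
have := le_trans tang rem.
have : 4 * ((g^T *m (Bi *m Bi) *m g) 0 0 + 2 * K * r / b * (g^T *m Bi *m g) 0 0)
   * rho ^+ (2 * k.+1) <= 4 * (vnorm g * (X + 2 * K * r / mu * vnorm xopt))
   * rho ^+ (2 * k.+1).
  by rewrite ler_wpM2r// ler_wpM2l.
move=> /[swap] /le_trans/[apply] F.
rewrite -(ler_pM2l ng0) -(@ler_pM2l _ 2)//; apply: le_trans (le_trans F _).
  by rewrite le_eqVlt; apply/orP; left; apply/eqP; ring.
by rewrite le_eqVlt; apply/orP; left; apply/eqP; ring.
Qed.
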